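(* Let $k\in\{1,2,3\}$ and $n>2k$. Let $X=X_1\cup X_2$ be the union of two distinct conjugacy classes of $S_n$, with $x_1\in X_1$, $x_2\in X_2$. For a labelling $\{i,j\}=\{1,2\}$, let $a_l$ denote the number of $l$-cycles of $x_i$ and $b_l$ the number of $l$-cycles of $x_j$ (so $a_1,b_1$ are the numbers of fixed points). Let $Y_k=S_k\times S_{n-k}\le S_n$. (i) If $k=1$, then $rS_n=XY_1$ for some positive integer $r$ if and only if, for some labelling $\{i,j\}=\{1,2\}$, one of the following holds: (1) $a_1=b_1=1$; (2) $a_1=0$, $b_1\geq 2$ and $|X_i|=(b_1-1)|X_j|$. (ii) If $k=2$, then $rS_n=XY_2$ for some positive integer $r$ if and only if, for some labelling $\{i,j\}=\{1,2\}$, one of the following holds: (1) $a_1=b_1=1$ and $a_2=b_2=1$; (2) $a_1=b_1=1$, $a_2=0$, $b_2\geq 2$ and $|X_i|=(b_2-1)|X_j|$; (3) $a_1=0$, $b_1=3$, $|X_i|=2|X_j|$ and $a_2=b_2=0$; (4) $a_1=0$, $b_1=2$, $|X_i|=|X_j|$ and $a_2+b_2=1$. (iii) If $k=3$, then $rS_n=XY_3$ for some positive integer $r$ if and only if, for some labelling $\{i,j\}=\{1,2\}$, one of the following holds: (1) $a_1=b_1=1$, $a_2=b_2=1$ and $a_3=b_3=0$; (2) $a_1=b_1=1$, $a_2=0$, $b_2\geq 2$, $|X_i|=(b_2-1)|X_j|$ and $a_3=b_3=0$; (3) $a_1=a_2=a_3=0$, $b_1=2$, $b_2=1$, $b_3=0$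 and $|X_i|=|X_j|$; (4) $a_1=0$, $a_2=1$, $b_1=2$, $b_2=0$, $|X_i|=|X_j|$ and $a_3+b_3=2$; (5) $a_1=0$, $a_2=0$, $b_1=3$, $b_2=0$, $|X_i|=2|X_j|$ and $2a_3+b_3=2$.
   Context: $Y_k=S_k\times S_{n-k}$ is the Young subgroup of $S_n$ consisting of the permutations preserving a fixed $k$-element subset of $\{1,\dots,n\}$ (and its complement). For a finite group $G$, subsets $A,B\subseteq G$ and a positive integer $r$, the notation $rG=AB$ (also written $A\cdot B=rG$) means that for every $g\in G$ there are exactly $r$ pairs $(a,b)\in A\times B$ with $ab=g$. *)

(* Defs.v *)
From mathcomp Require Import all_boot all_fingroup.

Set Implicit Arguments.
Unset Strict Implicit.
Unset Printing Implicit Defensive.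

Local Open Scope group_scope.

(* [r G = A B]: every element of [G] is a product [a * b] in exactly [r] ways. *)
Definition factorization (gT : finGroupType) (r : nat) (G A B : {set gT}) :
    Prop :=
  [/\ A \subset G, B \subset G &
      forall g, g \in G -> #|[set p in setX A B | p.1 * p.2 == g]| = r].

(* Fixed points are counted as 1-cycles: they are singleton orbits. *)
Definition ncycles (T : finType) (s : {perm T}) (l : nat) : nat :=
  #|[set c in porbits s | #|c| == l]|.

(* The copy of [S_k * S_(n-k)] attached to a [k]-element set [K]: the setwise
   stabiliser of [K] under the natural action. *)
Definition young (n : nat) (K : {set 'I_n}) : {set 'S_n} := 'N(K | 'P).

Definition some_labelling (n : nat)
    (P : {set 'S_n} -> 'S_n -> {set 'S_n} -> 'S_n -> Prop)
    (X1 : {set 'S_n}) (x1 : 'S_n) (X2 : {set 'S_n}) (x2 : 'S_n) : Prop :=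
  P X1 x1 X2 x2 \/ P X2 x2 X1 x1.

(* Main.v *)
Require Import Defs.
From mathcomp Require Import all_boot all_fingroup zify.

(** Let [X] be the union of the two classes.  A factorization of [g] is fixed by
    its left factor [x], and [x^-1 * g] preserves [K] exactly when [x] carries
    [g^-1 K] to [K].  So [r S_n = X Y_k] says that every [k]-set [J] is carried
    to [K] by the same number of elements of [X]
    ([factorization_uniform]).  As [X] is closed under conjugation, the number
    of [x] in [X] with [x A = B], here [moves X A B], depends only on [#|A|],
    [#|B|] and [#|A :&: B|] ([moves_intersection]), and the condition becomes:
    it takes one value for all pairs of [k]-sets.  Call [X] [k]-uniform then.

    The main step ([uniformP]) replaces [k]-uniformity by [k] linear equations:
    for [2k <= n], [X] is [k]-uniform if and only if for each [1 <= j <= k] an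
    element of [X] fixes on average exactly one [j]-set.  In terms of
    characters this says that [X] is annihilated by the non-trivial
    constituents of the permutation character on [k]-sets; the argument here is
    a double count instead.  For a [k]-set [A] and a [(k+1)]-set [K], the [x]
    with [x A] inside [K] can be sorted by [x A] or by the preimage of [K],
    which gives an identity between the numbers [moves] on [k]-sets and those
    on [(k+1)]-sets ([sum_moves_setD1]).  When one side is constant, the other
    side involves only two intersection sizes at a time, so the unknown values
    can be found one after the other.  Going down from [k+1] to [k] the
    recursion starts with disjoint sets, and the bound on [k] provides the
    points outside both sets that it needs; going up it starts with equal sets,
    and that starting value is what the average number of fixed [(k+1)]-sets
    provides.

    A set is fixed by [x] if and only if it is a union of cycles of [x], so the
    numbers of fixed 1-, 2- and 3-sets are polynomials in the numbers of 1-,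
    2- and 3-cycles ([fixed_sets_ncycles]).  With class sizes [u] and [v], the
    equation for [j = 1] reads [u * a_1 + v * b_1 = u + v]: either
    [a_1 = b_1 = 1], or one class has no fixed points and the ratio [u / v] is
    determined by the other.  Substituting this ratio into the equations for
    [j = 2] and [j = 3] leaves the listed cases. *)

Set Implicit Arguments.
Unset Strict Implicit.
Unset Printing Implicit Defensive.

(** * Counting the elements that carry one set to another *)

Section Moves.
Variable n : nat.
Implicit Types (A B K L M : {set 'I_n}) (x g : 'S_n) (X : {set 'S_n}).

Lemma imset_permM x g A : (x * g)%g @: A = g @: (x @: A).
Proof. by rewrite -imset_comp; apply: eq_imset => i; rewrite /= permM. Qed.

Lemma imset_perm1 A : (1%g : 'S_n) @: A = A.
Proof. by rewrite (eq_imset _ (perm1 (T := _))) imset_id. Qed.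

Lemma imset_permK x A : x^-1%g @: (x @: A) = A.
Proof. by rewrite -imset_permM mulgV imset_perm1. Qed.

Lemma imset_permKV x A : x @: (x^-1%g @: A) = A.
Proof. by rewrite -imset_permM mulVg imset_perm1. Qed.

Lemma imset_perm_inj g : injective (fun A => g @: A).
Proof. exact: imset_inj perm_inj. Qed.

Lemma card_imset_perm x A : #|x @: A| = #|A|.
Proof. exact: card_imset perm_inj. Qed.

Lemma imset_perm_eq x A B : (x @: A == B) = (A == x^-1%g @: B).
Proof.
by apply/eqP/eqP => [<-|->]; rewrite ?imset_permK ?imset_permKV.
Qed.

(** Colour each point by its membership in the two sets: equal cardinals make
    the two colour sequences rearrangements of each other, and a rearrangement
    of sequences indexed by ['I_n] is a permutation of ['I_n]. *)
Lemma exists_perm_pair A B A' B' :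
    #|A| = #|A'| -> #|B| = #|B'| -> #|A :&: B| = #|A' :&: B'| ->
  exists g : 'S_n, g @: A = A' /\ g @: B = B'.
Proof.
move=> eA eB eAB.
pose color (C D : {set 'I_n}) := [tuple (i \in C, i \in D) | i < n].
have count_color C D a b :
    count_mem (a, b) (color C D) =
      #|[set i : 'I_n | (i \in C) == a & (i \in D) == b]|.
  rewrite /= count_map cardsE cardE size_filter enumT.
  by apply: eq_count => i.
have card_color (C D : {set 'I_n}) a b :
    #|[set i : 'I_n | (i \in C) == a & (i \in D) == b]| =
      if a then if b then #|C :&: D| else #|C| - #|C :&: D|
      else if b then #|D| - #|C :&: D| else n - (#|C| + #|D| - #|C :&: D|).
  case: a; case: b.
  - by apply: eq_card => i; rewrite !inE !eqb_id.
  - rewrite -cardsD; apply: eq_card => i; rewrite !inE.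
    by do 2!case: (_ \in _).
  - rewrite [C :&: D]setIC -cardsD; apply: eq_card => i.
    by rewrite !inE; do 2!case: (_ \in _).
  - rewrite -cardsU -[X in X - _](card_ord n) -(cardsC (C :|: D)) addKn.
    by apply: eq_card => i; rewrite !inE; do 2!case: (_ \in _).
have: perm_eq (color A B) (color A' B').
  apply/allP => -[a b] _ /=; rewrite !count_color !card_color eA eB eAB //.
case/tuple_permP => p ep; exists p.
have ec i : (i \in A, i \in B) = (p i \in A', p i \in B').
  have := congr1 (fun s => nth (false, false) s i) ep.
  by rewrite -!tnth_nth !tnth_mktuple.
split; apply/setP => i; rewrite -[i](permKV p) (mem_imset _ _ (@perm_inj _ p));
  by case: (ec (p^-1%g i)).
Qed.

Definition moves X A B := #|[set x in X | x @: A == B]|.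

Lemma moves_imset X g A B : [set: 'S_n] \subset 'N(X)%g ->
  moves X (g @: A) (g @: B) = moves X A B.
Proof.
move=> nX; rewrite /moves -[RHS](card_imset _ (conjg_inj g)).
apply: eq_card => x; rewrite !inE -[x in RHS](conjgKV g).
rewrite (mem_imset _ _ (conjg_inj g)) !inE memJ_norm ?groupV; last first.
  exact: (subsetP nX).
congr (_ && _); rewrite conjgE invgK !imset_permM [RHS]imset_perm_eq.
by rewrite invgK.
Qed.

(** The pairs of sets with given sizes and a given intersection size form one
    orbit of the symmetric group. *)
Lemma moves_intersection X A B A' B' : [set: 'S_n] \subset 'N(X)%g ->
    #|A| = #|A'| -> #|B| = #|B'| -> #|A :&: B| = #|A' :&: B'| ->
  moves X A B = moves X A' B'.
Proof.
move=> nX eA eB eAB.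
have [g [<- <-]] := exists_perm_pair eA eB eAB.
by rewrite moves_imset.
Qed.

Lemma sum_moves_target X A :
  \sum_(B : {set 'I_n} | #|B| == #|A|) moves X A B = #|X|.
Proof.
rewrite -[RHS]sum1_card (partition_big (fun x : 'S_n => x @: A)
  (fun B => #|B| == #|A|)) /=.
  apply: eq_bigr => B _; rewrite /moves -sum1_card.
  by apply: eq_bigl => x; rewrite inE.
by move=> x _; rewrite card_imset_perm.
Qed.

Lemma sum_moves_diag X k :
  \sum_(A : {set 'I_n} | #|A| == k) moves X A A =
  \sum_(x in X) #|[set A : {set 'I_n} | #|A| == k & x @: A == A]|.
Proof.
under eq_bigr do rewrite /moves -sum1dep_card big_mkcondr.
rewrite exchange_big /=; apply: eq_bigr => x _.
by rewrite -big_mkcondr sum1dep_card.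
Qed.

(** Both sides count the [x] in [X] with [x @: A] inside [K], sorted by the
    image of [A] on the left and by the preimage of [K] on the right. *)
Lemma sum_moves_inside X A K :
  \sum_(L : {set 'I_n} | (#|L| == #|A|) && (L \subset K)) moves X A L =
  \sum_(B : {set 'I_n} | (#|B| == #|K|) && (A \subset B)) moves X B K.
Proof.
transitivity #|[set x in X | x @: A \subset K]|.
  rewrite -[RHS]sum1_card (partition_big (fun x : 'S_n => x @: A)
    (fun B => (#|B| == #|A|) && (B \subset K))) /=.
    apply: eq_bigr => B /andP[_ sBK]; rewrite /moves -sum1_card.
    apply: eq_bigl => x; rewrite !inE -andbA.
    by case: eqP => [->|]; rewrite ?sBK ?andbF.
  by move=> x; rewrite inE card_imset_perm eqxx => /andP[].
rewrite -[LHS]sum1_card (partition_big (fun x : 'S_n => x^-1%g @: K)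
    (fun B => (#|B| == #|K|) && (A \subset B))) /=.
  apply: eq_bigr => B /andP[_ sAB]; rewrite /moves -sum1_card.
  apply: eq_bigl => x; rewrite !inE -andbA imset_perm_eq [B == _]eq_sym.
  case: eqP => [e|]; rewrite ?andbF // !andbT -[K](imset_permKV x) e.
  by rewrite imsetS // andbT.
move=> x; rewrite inE card_imset_perm eqxx => /andP[_ sAK].
by rewrite -[A](imset_permK x) imsetS.
Qed.

(** The common value of [moves X A B] can only be [#|X| / 'C(n, k)]; multiplying
    out keeps the condition in the natural numbers. *)
Definition uniform X k :=
  forall A B, #|A| = k -> #|B| = k -> moves X A B * 'C(n, k) = #|X|.

(** * Uniformity in terms of fixed subsets *)

Lemma sum_setD1 K (F : {set 'I_n} -> nat) k : #|K| = k.+1 ->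
  \sum_(L : {set 'I_n} | (#|L| == k) && (L \subset K)) F L =
  \sum_(p in K) F (K :\ p).
Proof.
move=> cK; rewrite -(big_imset F (h := fun p => K :\ p)) /=; last first.
  move=> p q Kp Kq /setP/(_ p); rewrite !inE eqxx Kp !andbT /=.
  by move/esym/negbT; rewrite negbK => /eqP.
apply: eq_bigl => L; apply/andP/imsetP => [[/eqP cL sLK]|[p Kp ->]]; last first.
  by rewrite subsetDl; split=> //; have := cardsD1 p K; rewrite Kp cK => -[->].
have: #|K :\: L| == 1 by rewrite cardsD (setIidPr sLK) cK cL subSnn.
case/cards1P => p eKL; have: p \in K :\: L by rewrite eKL set11.
case/setDP => Kp _; exists p => //.
by rewrite -eKL setDDr setDv set0U (setIidPr sLK).
Qed.

Lemma sum_setU1 A (F : {set 'I_n} -> nat) :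
  \sum_(B : {set 'I_n} | (#|B| == #|A|.+1) && (A \subset B)) F B =
  \sum_(p in ~: A) F (p |: A).
Proof.
rewrite -(big_imset F (h := fun p => p |: A)) /=; last first.
  move=> p q; rewrite !inE => /negbTE Ap _ /setP/(_ p).
  by rewrite !inE eqxx Ap !orbF => /esym/eqP.
apply: eq_bigl => B; apply/andP/imsetP => [[/eqP cB sAB]|[p]]; last first.
  by rewrite inE => Ap ->; rewrite cardsU1 Ap subsetUr.
have: #|B :\: A| == 1 by rewrite cardsD (setIidPr sAB) cB subSnn.
case/cards1P => p eBA; have: p \in B :\: A by rewrite eBA set11.
case/setDP => Bp nAp; exists p; first by rewrite inE.
by rewrite -[LHS](setID B A) (setIidPr sAB) eBA setUC.
Qed.

Lemma sum_moves_setD1 X A K : #|K| = #|A|.+1 ->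
  \sum_(p in K) moves X A (K :\ p) = \sum_(p in ~: A) moves X (p |: A) K.
Proof.
by move=> cK; rewrite -(sum_setD1 _ cK) sum_moves_inside cK sum_setU1.
Qed.

Lemma card_setC_ord A : #|~: A| = n - #|A|.
Proof. by rewrite -[X in X - _](card_ord n) -(cardsC A) addKn. Qed.

Lemma sum_const_draws k r : \sum_(A : {set 'I_n} | #|A| == k) r = r * 'C(n, k).
Proof.
rewrite sum_nat_cond_const mulnC; congr (_ * _).
by rewrite -[in RHS](card_ord n) -card_draws; apply: eq_card => L; rewrite !inE.
Qed.

(** The step of both recursions on the intersection size: for the points of
    [S :&: D] the value is already known, and for the other points of [S] the
    two sets meet equally often, so they share one unknown value [m]. *)
Lemma average_rest (S D : {set 'I_n}) (F : 'I_n -> nat) (N m : nat) :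
    {in S :&: D, forall p, F p = N} -> {in S :\: D, forall p, F p = m} ->
    0 < #|S :\: D| -> \sum_(p in S) F p = #|S| * N ->
  m = N.
Proof.
move=> FD FC gt0; rewrite (big_setID D) /= (eq_bigr _ FD) (eq_bigr _ FC).
rewrite !sum_nat_const -(cardsID D S) mulnDl => /addnI/eqP.
by rewrite eqn_pmul2l // => /eqP.
Qed.

(** Uniformity on [k+1]-sets makes the normalized [moves X A (K :\ p)] average
    to [#|X|] over [p] in [K].  For [K = p0 |: L] with [p0] outside [A] and [L],
    the sets [K :\ p] meet [A] in [#|A :&: L|] points, or in one point fewer
    when [p] is in [A]; so the value for [L] follows from smaller
    intersections. *)
Lemma uniform_pred X k : [set: 'S_n] \subset 'N(X)%g -> 2 * k.+1 <= n ->
  uniform X k.+1 -> uniform X k.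
Proof.
move=> nX kn unif.
have average A K : #|A| = k -> #|K| = k.+1 ->
    \sum_(p in K) moves X A (K :\ p) * 'C(n, k) = #|K| * #|X|.
  move=> cA cK; apply/eqP; rewrite cK -(@eqn_pmul2r (n - k)); last by lia.
  rewrite -big_distrl /= sum_moves_setD1 ?cA // -mulnA [_ * (n - k)]mulnC.
  rewrite -mul_bin_left mulnCA -[eqbRHS]mulnA eqn_pmul2l // big_distrl /=.
  under eq_bigr => p; first rewrite inE => nAp.
    rewrite unif ?cardsU1 ?nAp ?cA //; over.
  by rewrite sum_nat_const card_setC_ord cA mulnC.
move=> A L cA cL.
have [t] := ubnP #|A :&: L|; elim: t L cL => // t IHt L cL lt.
have cAL := cardsUI A L.
have [|p] := @card_gt0P _ (mem (~: (A :|: L))) _.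
  by rewrite card_setC_ord; lia.
rewrite !inE negb_or => /andP[nAp nLp].
have cK : #|p |: L| = k.+1 by rewrite cardsU1 nLp cL.
have Kp : p \in p |: L by rewrite !inE eqxx.
have cKD1 q : q \in p |: L -> #|(p |: L) :\ q| = k.
  by move=> Kq; have := cardsD1 q (p |: L); rewrite Kq cK => -[].
have eAK : A :&: (p |: L) = A :&: L.
  by apply/setP => i; rewrite !inE; case: eqP => [->|//]; rewrite (negbTE nAp).
apply: (average_rest (S := p |: L) (D := A) _ _ _ (average A _ cA cK)).
- move=> q; rewrite inE => /andP[Kq Aq] /=; apply: IHt; first exact: cKD1.
  have : #|A :&: ((p |: L) :\ q)| < #|A :&: L|; last by lia.
  rewrite -eAK setIDA; apply: proper_card; apply: properD1.
  by rewrite !inE Aq -in_setU1.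
- move=> q; rewrite inE => /andP[nAq Kq] /=; congr (_ * _).
  apply: moves_intersection => //; first by rewrite cL cKD1.
  congr #|pred_of_set _|; rewrite setIDA eAK; apply/setP => i; rewrite !inE.
  by case: eqP => [->|//]; rewrite (negbTE nAq).
- by apply/card_gt0P; exists p; rewrite inE nAp.
Qed.

(** The mirror image of [uniform_pred]: now [moves X (p |: M) K] averages to the
    right value over [p] outside [M], and for [M = A :\ p0] with [p0] outside
    [B] the value for [(A, B)] follows from larger intersections.  The
    diagonal sum settles the case [A = B]. *)
Lemma uniform_succ X k : [set: 'S_n] \subset 'N(X)%g -> k < n ->
    uniform X k -> \sum_(A : {set 'I_n} | #|A| == k.+1) moves X A A = #|X| ->
  uniform X k.+1.
Proof.
move=> nX kn unif diag.
have average M K : #|M| = k -> #|K| = k.+1 ->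
    \sum_(p in ~: M) moves X (p |: M) K * 'C(n, k.+1) = #|~: M| * #|X|.
  move=> cM cK; apply/eqP; rewrite card_setC_ord cM -(@eqn_pmul2l k.+1) //.
  rewrite -big_distrl /= -sum_moves_setD1 ?cM // mulnCA mul_bin_left.
  rewrite mulnCA [eqbRHS]mulnCA eqn_pmul2l; last by lia.
  rewrite big_distrl /=.
  under eq_bigr => p Kp.
    rewrite unif //; first over.
    by have := cardsD1 p K; rewrite Kp cK => -[].
  by rewrite sum_nat_const cK.
move=> A B cA cB.
have [t] := ubnP #|A :\: B|; elim: t A cA => // t IHt A cA lt.
have [/eqP|] := posnP #|A :\: B|.
  rewrite cards_eq0 setD_eq0 => sAB.
  have {sAB lt} -> : A = B by apply/eqP; rewrite eqEcard sAB cA cB leqnn.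
  rewrite -diag (eq_bigr (fun=> moves X B B)); last first.
    by move=> L /eqP cL; apply: moves_intersection; rewrite ?setIid ?cL ?cB.
  by rewrite sum_const_draws.
case/card_gt0P => p /setDP[Ap nBp].
pose M := A :\ p.
have cM : #|M| = k by have := cardsD1 p A; rewrite Ap cA => -[].
have eA : p |: M = A by rewrite setD1K.
have nMp : p \in ~: M by rewrite !inE eqxx.
apply: (average_rest (S := ~: M) (D := B) _ _ _ (average M B cM cB)).
- move=> q /setIP[]; rewrite in_setC => nMq Bq /=; apply: IHt.
    by rewrite cardsU1 nMq cM.
  have : #|(q |: M) :\: B| < #|A :\: B|; last by lia.
  apply: (leq_ltn_trans (n := #|(A :\: B) :\ p|)).
    apply: subset_leq_card; apply/subsetP => i; rewrite !inE.
    by have [->|_] := eqVneq i q; rewrite ?Bq //= andbCA.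
  by apply: proper_card; apply: properD1; rewrite inE nBp.
- move=> q /setDP[]; rewrite in_setC => nMq nBq /=; congr (_ * _).
  apply: moves_intersection => //; first by rewrite cardsU1 nMq cM cA.
  congr #|pred_of_set _|; rewrite -eA; apply/setP => i; rewrite !inE.
  case: eqP => [->|_]; case: eqP => [->|_];
    by rewrite ?(negbTE nBp) ?(negbTE nBq) ?andbF.
- by apply/card_gt0P; exists p; rewrite inE nBp.
Qed.

Definition fixed_sets (x : 'S_n) j :=
  #|[set A : {set 'I_n} | #|A| == j & x @: A == A]|.

Lemma uniform_diag X k : k <= n -> uniform X k ->
  \sum_(A : {set 'I_n} | #|A| == k) moves X A A = #|X|.
Proof.
move=> kn unif; apply/eqP; rewrite -(@eqn_pmul2r 'C(n, k)) ?bin_gt0 //.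
rewrite big_distrl /=; under eq_bigr => A /eqP cA do rewrite unif //.
by rewrite sum_const_draws.
Qed.

(** Of the matrix [moves X] on [j]-sets, only its trace enters the step from
    [j - 1] to [j], and the trace counts the [j]-sets fixed by elements of
    [X]. *)
Lemma uniformP X k : [set: 'S_n] \subset 'N(X)%g -> 2 * k <= n ->
  uniform X k <->
  forall j, 0 < j <= k -> \sum_(x in X) fixed_sets x j = #|X|.
Proof.
move=> nX; elim: k => [|k IHk] kn.
  split=> [_ j|_ A B]; first by lia.
  move=> /cards0_eq -> /cards0_eq ->; rewrite bin0 muln1.
  by apply: eq_card => x; rewrite !inE imset0 eqxx andbT.
have {}IHk : uniform X k <-> _ := IHk ltac:(lia).
split=> [unif j /andP[j0]|avg].
  rewrite leq_eqVlt => /predU1P[->|jk].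
    by rewrite -sum_moves_diag uniform_diag //; lia.
  by apply IHk; [exact: uniform_pred unif | rewrite j0].
apply: uniform_succ => //; first by lia.
  by apply/IHk => j /andP[j0 jk]; apply: avg; rewrite j0 ltnW.
by rewrite sum_moves_diag avg //= ltn0Sn leqnn.
Qed.

(** * Fixed subsets are unions of cycles *)

Lemma imset_porbit x c : c \in porbits x -> x @: c = c.
Proof.
case/imsetP => i _ ->; apply/eqP; rewrite eqEcard card_imset_perm leqnn andbT.
apply/subsetP => _ /imsetP[_ /porbitP[k ->] ->].
by rewrite -permM -expgSr mem_porbit.
Qed.

(** Taking unions is a bijection from sets of cycles to fixed sets, because the
    cycles are disjoint, non-empty and cover all points. *)
Lemma fixed_sets_porbits x j :
  fixed_sets x j =
  #|[set D : {set {set 'I_n}} | D \subset porbits x & \sum_(c in D) #|c| == j]|.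
Proof.
have triv (D : {set {set 'I_n}}) : D \subset porbits x -> trivIset D.
  move=> sD; apply: trivIsetS sD _; apply/trivIsetP.
  move=> _ _ /imsetP[i _ ->] /imsetP[k _ ->] neq.
  apply/pred0P => y /=; apply/negbTE/negP => /andP[].
  by rewrite -!eq_porbit_mem => /eqP -> /idPn[]; rewrite (negbTE neq).
have inside (D : {set {set 'I_n}}) (c : {set 'I_n}) :
    D \subset porbits x -> c \in porbits x -> (c \subset cover D) = (c \in D).
  move=> sD cP; apply/idP/idP => [|cD]; last exact: bigcup_sup.
  have /imsetP[i _ ec] := cP; rewrite ec => /subsetP/(_ i (porbit_id x i)).
  case/bigcupP => d dD id; have /imsetP[k _ ed] := subsetP sD d dD.
  suff -> : porbit x i = d by [].
  by rewrite ed; apply/eqP; rewrite eq_porbit_mem -ed.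
rewrite /fixed_sets -(card_in_imset (f := @cover _)); last first.
  move=> D E; rewrite !inE => /andP[sD _] /andP[sE _] eDE; apply/setP => c.
  have [cP|ncP] := boolP (c \in porbits x).
    by rewrite -(inside D) // eDE inside.
  by apply/idP/idP => [/(subsetP sD)|/(subsetP sE)]; rewrite (negbTE ncP).
apply: eq_card => A; rewrite inE; apply/andP/imsetP => [[/eqP cA /eqP xA]|[D]].
  pose D := [set c in porbits x | c \subset A].
  have sD : D \subset porbits x by apply/subsetP => c; rewrite inE => /andP[].
  have eA : A = cover D.
    apply/eqP; rewrite eqEsubset; apply/andP; split; last first.
      by apply/bigcupsP => c; rewrite inE => /andP[].
    apply/subsetP => i Ai; apply/bigcupP.
    exists (porbit x i); rewrite ?porbit_id //.
    rewrite inE imset_f //=; apply/subsetP => _ /porbitP[k ->].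
    elim: k => [|k IHk]; first by rewrite expg0 perm1.
    by rewrite expgSr permM -xA imset_f.
  exists D => //; rewrite inE sD /=.
  by have := triv D sD; rewrite /trivIset -eA cA.
rewrite inE => /andP[sD /eqP sumD] ->; split.
  by have := triv D sD; rewrite /trivIset sumD eq_sym.
rewrite eqEcard card_imset_perm leqnn andbT.
apply/subsetP => _ /imsetP[i /bigcupP[c cD ic] ->]; apply/bigcupP; exists c => //.
by rewrite -(imset_porbit (subsetP sD c cD)) imset_f.
Qed.

End Moves.

Section SubsetSums.
Variable T : finType.
Variable w : T -> nat.
Implicit Types (S : {set T}) (c : T).

Definition subset_sums S j :=
  #|[set D : {set T} | D \subset S & \sum_(c in D) w c == j]|.
Definition of_weight S l := #|[set c in S | w c == l]|.

(** Multiplying a generating function by the factor of the new element: the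
    numbers [subset_sums S j] are the coefficients of the product of the
    [1 + z ^ w c] for [c] in [S]. *)
Lemma subset_sumsU1 S c j : c \notin S ->
  subset_sums (c |: S) j =
  subset_sums S j + (if w c <= j then subset_sums S (j - w c) else 0).
Proof.
move=> Sc; rewrite /subset_sums -(cardsID [set D : {set T} | c \in D]) addnC.
have notin (D : {set T}) : D \subset S -> c \notin D.
  by move=> /subsetP s; apply: contra (s c) Sc.
congr (_ + _).
  apply: eq_card => D; rewrite !inE andbA; congr (_ && _).
  apply/andP/idP => [[cD sD]|sD].
    apply/subsetP => d dD.
    by case/setU1P: (subsetP sD d dD) cD => [<-|]; rewrite ?dD.
  by rewrite notin // (subset_trans sD (subsetUr _ _)).
have sumU1 (D : {set T}) :
    c \notin D -> \sum_(d in c |: D) w d = w c + \sum_(d in D) w d.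
  exact: big_setU1.
transitivity #|(fun D => c |: D) @: [set D : {set T} |
    (D \subset S) && (w c + \sum_(d in D) w d == j)]|.
  apply: eq_card => D; rewrite !inE; apply/andP/imsetP => [[/andP[sD sumD] cD]|].
    exists (D :\ c); last by rewrite setD1K.
    by rewrite inE subDset sD -sumU1 ?setD1K // !inE eqxx.
  case=> E; rewrite inE => /andP[sE sumE] ->.
  by rewrite setU11 setUS // sumU1 ?notin.
rewrite card_in_imset; last first.
  move=> D E; rewrite !inE => /andP[/notin cD _] /andP[/notin cE _] eDE.
  by rewrite -(setU1K cD) eDE setU1K.
case: leqP => wj; last first.
  by apply: eq_card0 => D; rewrite inE; apply/negP => /andP[_ /eqP]; lia.
by apply: eq_card => D; rewrite !inE; congr (_ && _); apply/eqP/eqP; lia.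
Qed.

Lemma subset_sums0 S : {in S, forall c, 0 < w c} -> subset_sums S 0 = 1.
Proof.
move=> w_gt0.
rewrite /subset_sums -(cards1 (set0 : {set T})); apply: eq_card => D; rewrite !inE.
apply/andP/eqP => [[/subsetP sD sumD]|->]; last by rewrite sub0set big_set0.
apply/eqP; rewrite -subset0; apply/subsetP => d dD.
by move: sumD; rewrite (big_setD1 d) //= addn_eq0; have := w_gt0 d (sD d dD); case: (w d).
Qed.

(** The coefficients of [z], [z^2] and [z^3] in that product come from
    [(1 + z) ^ a1 * (1 + z^2) ^ a2 * (1 + z^3) ^ a3], where [al] is the number
    of elements of weight [l], as heavier elements contribute nothing below
    [z^4].  The three formulas are checked together, adding one element at a
    time. *)
Lemma subset_sums_small S : {in S, forall c, 0 < w c} ->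
  [/\ subset_sums S 1 = of_weight S 1,
      subset_sums S 2 = 'C(of_weight S 1, 2) + of_weight S 2 &
      subset_sums S 3 = 'C(of_weight S 1, 3) + of_weight S 1 * of_weight S 2
                        + of_weight S 3].
Proof.
have [m] := ubnP #|S|; elim: m S => // m IHm S lt w_gt0.
have [->|[c cS]] := set_0Vmem S.
  have o0 l : of_weight set0 l = 0 by apply: eq_card0 => c; rewrite !inE.
  have s0 j : 0 < j -> subset_sums set0 j = 0.
    move=> j0; apply: eq_card0 => D; rewrite !inE subset0.
    by apply/negP => /andP[/eqP -> /eqP]; rewrite big_set0; lia.
  by rewrite !o0 !s0.
have nSc : c \notin S :\ c by rewrite !inE eqxx.
have w_gt0' : {in S :\ c, forall d, 0 < w d} by move=> d /setD1P[_]; apply: w_gt0.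
have [|IH1 IH2 IH3] := IHm (S :\ c) _ w_gt0'.
  by have := cardsD1 c S; rewrite cS; lia.
have oU l : of_weight S l = (w c == l) + of_weight (S :\ c) l.
  rewrite /of_weight (cardsD1 c) !inE cS /=; congr (_ + _).
  by apply: eq_card => d; rewrite !inE andbA.
rewrite -(setD1K cS) !subset_sumsU1 // setD1K // !oU.
have := w_gt0 c cS; case: (w c) => [//|[|[|[|l]]]] _ /=;
  rewrite ?subn1 ?subnn ?(subset_sums0 w_gt0') /= ?IH1 ?IH2 ?IH3 ?subnn
    ?(subset_sums0 w_gt0') ?add0n ?add1n ?binS ?bin1 ?bin0 /=; split; try nia.
Qed.

End SubsetSums.

(** * Fixed subsets and cycle numbers *)

Lemma fixed_sets_ncycles n (x : 'S_n) :
  [/\ fixed_sets x 1 = ncycles x 1,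
      fixed_sets x 2 = 'C(ncycles x 1, 2) + ncycles x 2 &
      fixed_sets x 3 = 'C(ncycles x 1, 3) + ncycles x 1 * ncycles x 2
                       + ncycles x 3].
Proof.
rewrite !fixed_sets_porbits.
apply: (@subset_sums_small _ (fun c : {set 'I_n} => #|c|) (porbits x)).
by move=> c /imsetP[i _ ->]; rewrite lt0n card_porbit_neq0.
Qed.

Lemma fixed_setsJ n (x g : 'S_n) j : fixed_sets (x ^ g)%g j = fixed_sets x j.
Proof.
rewrite /fixed_sets -[RHS](card_imset _ (@imset_perm_inj _ g)).
have stable (B : {set 'I_n}) : ((x ^ g)%g @: (g @: B) == g @: B) = (x @: B == B).
  by rewrite conjgE !imset_permM imset_perm_eq imset_permK.
apply: eq_card => A; apply/idP/imsetP => [|[B + ->]]; rewrite inE.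
  move=> hA; exists (g^-1%g @: A); last by rewrite imset_permKV.
  by rewrite inE -stable imset_permKV card_imset_perm.
by rewrite inE stable card_imset_perm.
Qed.

(** * Factorizations by a Young subgroup *)

Lemma mem_young n (K : {set 'I_n}) (s : 'S_n) : (s \in young K) = (s @: K == K).
Proof.
apply/astabsP/eqP => [sK|sK i].
  apply/setP => i; rewrite -[i](permKV s) (mem_imset _ _ perm_inj).
  by rewrite -(sK (s^-1%g i)).
by rewrite /= apermE -{1}sK (mem_imset _ _ perm_inj).
Qed.

Lemma card_factors n (X : {set 'S_n}) (K : {set 'I_n}) (g : 'S_n) :
  #|[set p in setX X (young K) | (p.1 * p.2)%g == g]| = moves X (g^-1%g @: K) K.
Proof.
pose pair_of (x : 'S_n) := (x, x^-1 * g)%g.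
have pair_inj : injective pair_of by move=> x y [].
rewrite /moves -(card_imset _ pair_inj); apply: eq_card => -[x y].
rewrite in_set in_setX /= mem_young.
apply/idP/imsetP => [/andP[/andP[Xx /eqP yK] /eqP eg]|[z]].
  have ey : y = (x^-1 * g)%g by rewrite -eg mulKg.
  exists x; last by rewrite ey.
  by rewrite inE Xx imset_perm_eq imset_perm_eq invgK -imset_permM -ey yK /=.
rewrite inE => /andP[Xz zK] [-> ->]; rewrite Xz mulKVg eqxx andbT.
by rewrite imset_permM imset_perm_eq imset_perm_eq invgK eq_sym.
Qed.

(** Factorizations only see the values [moves X J K] with the fixed target [K];
    conjugation gives the other targets.  The common value is found by summing
    over the targets of [K], which have the same values because [A] and [B] may
    be exchanged in [moves X A B] when they have equal size. *)
Lemma factorization_uniform n (X : {set 'S_n}) (K : {set 'I_n}) :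
    [set: 'S_n] \subset 'N(X)%g -> X != set0 ->
  (exists r, 0 < r /\ factorization r [set: 'S_n] X (young K)) <->
  uniform X #|K|.
Proof.
move=> nX X0; have ord_n : #|'I_n| = n := card_ord n.
have C_gt0 : 0 < 'C(n, #|K|) by rewrite bin_gt0 -[leqRHS]ord_n max_card.
have toK (A : {set 'I_n}) : #|A| = #|K| -> exists g : 'S_n, g @: A = K.
  move=> cA; have [|||g [gA _]] := @exists_perm_pair _ A A K K => //.
    by rewrite !setIid.
  by exists g.
split=> [[r [r0 [_ _ fact]]] A B cA cB|unif].
  have toKr (D : {set 'I_n}) : #|D| = #|K| -> moves X D K = r.
    move=> cD; have [g gD] := toK D cD.
    by rewrite -(imset_permK g D) gD -card_factors fact ?inE.
  have [g gB] := toK B cB.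
  rewrite -(moves_imset g) // gB toKr ?card_imset_perm //.
  rewrite -(sum_moves_target X K) (eq_bigr (fun=> r)); last first.
    move=> D /eqP cD; rewrite -(toKr D cD).
    by apply: moves_intersection; rewrite ?cD // setIC.
  by rewrite sum_const_draws.
exists (moves X K K); split.
  have: 0 < moves X K K * 'C(n, #|K|) by rewrite unif // card_gt0.
  by rewrite muln_gt0 => /andP[].
split; rewrite ?subsetT // => g _; rewrite card_factors; apply/eqP.
by rewrite -(@eqn_pmul2r 'C(n, #|K|)) // !unif ?card_imset_perm.
Qed.

(** * Solving the equations *)

(** If one of the values exceeds 1, the other must lie below 1, hence be 0, and
    the equation determines the ratio of the weights. *)
Lemma mean_one_two u v a b : 0 < u -> 0 < v -> u * a + v * b = u + v ->
  [\/ a = 1 /\ b = 1, [/\ a = 0, 2 <= b & u = (b - 1) * v]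
    | [/\ b = 0, 2 <= a & v = (a - 1) * u]].
Proof.
move=> u0 v0; case: a => [|[|a]] h.
- by constructor 2; split=> //; nia.
- by constructor 1; split=> //; nia.
- by constructor 3; case: b h => [|b] h; split=> //; nia.
Qed.

(** The case lists for one labelling, in terms of the class sizes [u], [v] and
    the cycle numbers [a], [b] alone, so that the remaining arithmetic is
    independent of permutations. *)
Definition condition1 u (a : nat -> nat) v (b : nat -> nat) :=
  (a 1 = 1 /\ b 1 = 1) \/ [/\ a 1 = 0, 2 <= b 1 & u = (b 1 - 1) * v].

Definition condition2 u (a : nat -> nat) v (b : nat -> nat) :=
  [\/ [/\ a 1 = 1, b 1 = 1, a 2 = 1 & b 2 = 1],
      [/\ a 1 = 1, b 1 = 1, a 2 = 0, 2 <= b 2 & u = (b 2 - 1) * v],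
      [/\ a 1 = 0, b 1 = 3, u = 2 * v, a 2 = 0 & b 2 = 0]
    | [/\ a 1 = 0, b 1 = 2, u = v & a 2 + b 2 = 1]].

Definition condition3 u (a : nat -> nat) v (b : nat -> nat) :=
  (a 1 = 1 /\ b 1 = 1 /\ a 2 = 1 /\ b 2 = 1 /\ a 3 = 0 /\ b 3 = 0) \/
  (a 1 = 1 /\ b 1 = 1 /\ a 2 = 0 /\ 2 <= b 2 /\
    u = (b 2 - 1) * v /\ a 3 = 0 /\ b 3 = 0) \/
  (a 1 = 0 /\ a 2 = 0 /\ a 3 = 0 /\ b 1 = 2 /\ b 2 = 1 /\ b 3 = 0 /\ u = v) \/
  (a 1 = 0 /\ a 2 = 1 /\ b 1 = 2 /\ b 2 = 0 /\ u = v /\ a 3 + b 3 = 2) \/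
  (a 1 = 0 /\ a 2 = 0 /\ b 1 = 3 /\ b 2 = 0 /\ u = 2 * v /\ 2 * a 3 + b 3 = 2).

(** The [mean] equations say that the union of a class of size [u] with cycle
    numbers [a] and one of size [v] with cycle numbers [b] fixes on average one
    set of 1, 2 or 3 points. *)
Definition mean1 u (a : nat -> nat) v (b : nat -> nat) := u * a 1 + v * b 1 = u + v.
Definition mean2 u (a : nat -> nat) v (b : nat -> nat) :=
  u * ('C(a 1, 2) + a 2) + v * ('C(b 1, 2) + b 2) = u + v.
Definition mean3 u (a : nat -> nat) v (b : nat -> nat) :=
  u * ('C(a 1, 3) + a 1 * a 2 + a 3) + v * ('C(b 1, 3) + b 1 * b 2 + b 3) = u + v.

Lemma mean1P u a v b : 0 < u -> 0 < v ->
  mean1 u a v b <-> condition1 u a v b \/ condition1 v b u a.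
Proof.
rewrite /mean1 /condition1 => u0 v0; split.
  by case/(mean_one_two u0 v0) => h; [left; left | left; right | right; right].
by case=> -[[-> ->]|[-> ? ->]]; nia.
Qed.

(** When [a 1 = b 1 = 1] the equation has the form treated by [mean_one_two],
    now for 2-cycles.  Otherwise [u = (b 1 - 1) * v], and after division by [v]
    the term ['C(b 1, 2)] forces [b 1 <= 3]. *)
Lemma condition1_mean2 u a v b : 0 < u -> 0 < v ->
  condition1 u a v b -> mean2 u a v b -> condition2 u a v b \/ condition2 v b u a.
Proof.
rewrite /mean2 => u0 v0 [[a1 b1]|[a1 b1 eu]].
  rewrite a1 b1 !bin_small // !add0n => /(mean_one_two u0 v0)[[]|[]|[]] ? ? *.
  - by left; constructor 1.
  - by left; constructor 2.
  - by right; constructor 2.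
rewrite a1 eu bin0n add0n => h.
have {}h : (b 1 - 1) * a 2 + ('C(b 1, 2) + b 2) = b 1.
  by apply/eqP; rewrite -(eqn_pmul2r v0); apply/eqP; nia.
left; move: b1 eu h; rewrite /condition2 a1.
case: (b 1) => [|[|[|[|m]]]] // _; rewrite ?binS ?bin1 ?bin0 ?bin0n /= => eu h.
- constructor 4; split=> //; lia.
- constructor 3; split=> //; lia.
- by nia.
Qed.

Lemma condition1_of2 u a v b : condition2 u a v b -> condition1 u a v b.
Proof.
case=> [[? ? _ _]|[? ? _ _ _]|[? b1 -> _ _]|[? b1 -> _]]; [by left|by left|right|right].
  by rewrite b1; split.
by rewrite b1 mul1n; split.
Qed.

Lemma mean2_of_condition2 u a v b : condition2 u a v b -> mean2 u a v b.
Proof.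
rewrite /mean2.
case=> [[-> -> -> ->]|[-> -> -> ? ->]|[-> -> -> -> ->]|[-> -> -> ?]];
  rewrite ?binS ?bin1 ?bin0 ?bin0n /=; nia.
Qed.

(** In each case the earlier equations give [u / v] and the numbers of 1- and
    2-cycles well enough for the third one to be linear in [a 3] and [b 3], so
    the labelling need not change. *)
Lemma condition2_mean3 u a v b : 0 < u -> 0 < v ->
  condition2 u a v b -> mean3 u a v b -> condition3 u a v b.
Proof.
rewrite /mean3 /condition3 => u0 v0.
case=> [[-> -> -> ->]|[-> -> -> ? ->]|[-> -> -> -> ->]|[-> -> ->]].
- rewrite !bin_small // => h; left.
  by have [-> ->] : a 3 = 0 /\ b 3 = 0; first (split; nia).
- rewrite !bin_small // => h; right; left.
  have : (b 2 - 1) * v * a 3 + v * b 3 = 0 by nia.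
  by move/eqP; rewrite addn_eq0 !muln_eq0 => /andP[]; lia.
- rewrite bin0n binn => h; right; right; right; right; do !split=> //; nia.
- rewrite bin0n bin_small // => ab h.
  have {}h : a 3 + 2 * b 2 + b 3 = 2 by nia.
  case: (a 2) ab => [|[|//]] => b2; last first.
    by right; right; right; left; do !split => //; lia.
  by right; right; left; do !split => //; lia.
Qed.

Lemma condition2_of3 u a v b : condition3 u a v b -> condition2 u a v b.
Proof.
rewrite /condition3 /condition2.
case=> [[? [? [? [? _]]]]|]; first by constructor 1.
case=> [[? [? [? [? [? _]]]]]|]; first by constructor 2.
case=> [[? [-> [_ [? [-> [_ ?]]]]]]|]; first by constructor 4.
case=> [[? [-> [? [-> [? _]]]]]|]; first by constructor 4.
by case=> ? [? [? [? [? _]]]]; constructor 3.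
Qed.

Lemma mean3_of_condition3 u a v b : condition3 u a v b -> mean3 u a v b.
Proof.
rewrite /mean3.
case=> [[-> [-> [-> [-> [-> ->]]]]]|]; first by rewrite !bin_small //; nia.
case=> [[-> [-> [-> [? [-> [-> ->]]]]]]|]; first by rewrite !bin_small //; nia.
case=> [[-> [-> [-> [-> [-> [-> ->]]]]]]|]; first by rewrite !bin_small //; nia.
case=> [[-> [-> [-> [-> [-> ?]]]]]|]; first by rewrite !bin_small //; nia.
by case=> -> [-> [-> [-> [-> ?]]]]; rewrite bin_small // binn; nia.
Qed.

Lemma mean2C u a v b : mean2 u a v b <-> mean2 v b u a.
Proof. by rewrite /mean2 addnC [v + u]addnC. Qed.

Lemma mean3C u a v b : mean3 u a v b <-> mean3 v b u a.
Proof. by rewrite /mean3 addnC [v + u]addnC. Qed.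

Lemma mean12P u a v b : 0 < u -> 0 < v ->
  (mean1 u a v b /\ mean2 u a v b) <-> condition2 u a v b \/ condition2 v b u a.
Proof.
move=> u0 v0; rewrite mean1P //; split=> [[[c|c] m]|[c|c]].
- exact: condition1_mean2.
- by rewrite or_comm; apply: condition1_mean2 => //; apply/mean2C.
- by split; [left; apply: condition1_of2 | apply: mean2_of_condition2].
- by split; [right; apply: condition1_of2 | apply/mean2C/mean2_of_condition2].
Qed.

Lemma mean123P u a v b : 0 < u -> 0 < v ->
  (mean1 u a v b /\ mean2 u a v b /\ mean3 u a v b) <->
  condition3 u a v b \/ condition3 v b u a.
Proof.
move=> u0 v0; rewrite -and_assoc mean12P //; split=> [[[c|c] m]|[c|c]].
- by left; apply: condition2_mean3.
- by right; apply: condition2_mean3 => //; apply/mean3C.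
- by split; [left; apply: condition2_of3 | apply: mean3_of_condition3].
- by split; [right; apply: condition2_of3 | apply/mean3C/mean3_of_condition3].
Qed.

(** * The classification *)

Lemma upto1 (P : nat -> Prop) : (forall j, 0 < j <= 1 -> P j) <-> P 1.
Proof. by split=> [|h [|[|j]]] //; apply. Qed.

Lemma upto2 (P : nat -> Prop) :
  (forall j, 0 < j <= 2 -> P j) <-> P 1 /\ P 2.
Proof. by split=> [h|[h1 h2] [|[|[|j]]]] //; split; apply: h. Qed.

Lemma upto3 (P : nat -> Prop) :
  (forall j, 0 < j <= 3 -> P j) <-> P 1 /\ P 2 /\ P 3.
Proof. by split=> [h|[h1 [h2 h3]] [|[|[|[|j]]]]] //; do !split; apply: h. Qed.

Lemma sum_fixed_sets_class n (X : {set 'S_n}) x j :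
    X \in classes [set: 'S_n] -> x \in X ->
  \sum_(y in X) fixed_sets y j = #|X| * fixed_sets x j.
Proof.
case/imsetP => z _ ->; rewrite class_sym => zx.
rewrite -sum_nat_const; apply: eq_bigr => y /imsetP[g _ ->].
by case/imsetP: zx => h _ ->; rewrite !fixed_setsJ.
Qed.

Theorem theorem3p4 (k n : nat) (hk : k \in [:: 1; 2; 3]) (hn : 2 * k < n)
    (K : {set 'I_n}) (hK : #|K| = k)
    (X1 X2 : {set 'S_n})
    (hX1 : X1 \in classes [set: 'S_n]) (hX2 : X2 \in classes [set: 'S_n])
    (hX12 : X1 <> X2)
    (x1 x2 : 'S_n) (hx1 : x1 \in X1) (hx2 : x2 \in X2) :
  [/\ k = 1 ->
      ((exists r : nat, 0 < r /\
          factorization r [set: 'S_n] (X1 :|: X2) (young K)) <->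
       some_labelling (fun Xi xi Xj xj =>
         let a := ncycles xi in let b := ncycles xj in
         (a 1 = 1 /\ b 1 = 1) \/
         [/\ a 1 = 0, 2 <= b 1 & #|Xi| = (b 1 - 1) * #|Xj|])
         X1 x1 X2 x2),
      k = 2 ->
      ((exists r : nat, 0 < r /\
          factorization r [set: 'S_n] (X1 :|: X2) (young K)) <->
       some_labelling (fun Xi xi Xj xj =>
         let a := ncycles xi in let b := ncycles xj in
         [\/ [/\ a 1 = 1, b 1 = 1, a 2 = 1 & b 2 = 1],
             [/\ a 1 = 1, b 1 = 1, a 2 = 0, 2 <= b 2
               & #|Xi| = (b 2 - 1) * #|Xj|],
             [/\ a 1 = 0, b 1 = 3, #|Xi| = 2 * #|Xj|, a 2 = 0 & b 2 = 0]
           | [/\ a 1 = 0, b 1 = 2, #|Xi| = #|Xj| & a 2 + b 2 = 1]])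
         X1 x1 X2 x2)
    & k = 3 ->
      ((exists r : nat, 0 < r /\
          factorization r [set: 'S_n] (X1 :|: X2) (young K)) <->
       some_labelling (fun Xi xi Xj xj =>
         let a := ncycles xi in let b := ncycles xj in
         (a 1 = 1 /\ b 1 = 1 /\ a 2 = 1 /\ b 2 = 1 /\ a 3 = 0 /\ b 3 = 0) \/
         (a 1 = 1 /\ b 1 = 1 /\ a 2 = 0 /\ 2 <= b 2 /\
           #|Xi| = (b 2 - 1) * #|Xj| /\ a 3 = 0 /\ b 3 = 0) \/
         (a 1 = 0 /\ a 2 = 0 /\ a 3 = 0 /\ b 1 = 2 /\ b 2 = 1 /\ b 3 = 0 /\
           #|Xi| = #|Xj|) \/
         (a 1 = 0 /\ a 2 = 1 /\ b 1 = 2 /\ b 2 = 0 /\ #|Xi| = #|Xj| /\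
           a 3 + b 3 = 2) \/
         (a 1 = 0 /\ a 2 = 0 /\ b 1 = 3 /\ b 2 = 0 /\ #|Xi| = 2 * #|Xj| /\
           2 * a 3 + b 3 = 2))
         X1 x1 X2 x2)].
Proof.
have nX : [set: 'S_n] \subset 'N(X1 :|: X2)%g.
  by rewrite normsU //; [case/imsetP: hX1 | case/imsetP: hX2] => z _ ->;
     apply: class_norm.
have dX : [disjoint X1 & X2].
  apply/pred0P => z /=; apply/negbTE/negP => /andP[].
  case/imsetP: hX1 hX12 => y1 _ ->; case/imsetP: hX2 => y2 _ -> neq.
  by move=> /class_eqP e1 /class_eqP e2; apply: neq; apply: etrans (esym e1) e2.
have X0 : X1 :|: X2 != set0 by apply/set0Pn; exists x1; rewrite inE hx1.
have u0 : 0 < #|X1| by apply/card_gt0P; exists x1.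
have v0 : 0 < #|X2| by apply/card_gt0P; exists x2.
have [p1 p2 p3] := fixed_sets_ncycles x1.
have [q1 q2 q3] := fixed_sets_ncycles x2.
have card_X : #|X1 :|: X2| = #|X1| + #|X2|.
  by rewrite (cardsU X1) (disjoint_setI0 dX) cards0 subn0.
have total j : \sum_(x in X1 :|: X2) fixed_sets x j =
    #|X1| * fixed_sets x1 j + #|X2| * fixed_sets x2 j.
  rewrite -(sum_fixed_sets_class j hX1 hx1) -(sum_fixed_sets_class j hX2 hx2).
  by rewrite -bigU //; apply: eq_bigl => y; rewrite !inE.
have := total 1; have := total 2; have := total 3.
rewrite p1 p2 p3 q1 q2 q3 => t3 t2 t1.
have hKn : 2 * #|K| <= n by rewrite hK ltnW.
have := iff_trans (factorization_uniform K nX X0) (uniformP nX hKn).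
rewrite hK card_X => criterion.
split=> ek; apply: (iff_trans criterion); rewrite ek.
- rewrite upto1 t1; exact: (mean1P (ncycles x1) (ncycles x2) u0 v0).
- rewrite upto2 t1 t2; exact: (mean12P (ncycles x1) (ncycles x2) u0 v0).
- rewrite upto3 t1 t2 t3; exact: (mean123P (ncycles x1) (ncycles x2) u0 v0).
Qed.
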